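(* Let $n\ge2$, $p\in[1,n)$ and $\tau\in[-1,1]$. The general $p$-affine capacity is continuous from above: if $\{K_i\}_{i=1}^\infty$ is a decreasing sequence of compact sets in $\mathbb{R}^n$ (i.e. $K_{i+1}\subset K_i$ for all $i$), then $$C_{p,\tau}\Big(\bigcap_{i=1}^\infty K_i\Big)=\lim_{i\to\infty}C_{p,\tau}(K_i).$$
   Context: $du$ is the rotation-invariant probability measure on $S^{n-1}$. For $\tau\in[-1,1]$ let $\varphi_\tau(t)=\big(\tfrac{1+\tau}{2}\big)^{1/p}t_++\big(\tfrac{1-\tau}{2}\big)^{1/p}t_-$, with $t_+=\max\{t,0\}$, $t_-=\max\{-t,0\}$. For $f\in C_c^\infty(\mathbb{R}^n)$ let $$\mathcal{H}_{p,\tau}(f)=\Big(\int_{S^{n-1}}\Big(\int_{\mathbb{R}^n}[\varphi_\tau(u\cdot\nabla f(x))]^p\,dx\Big)^{-n/p}du\Big)^{-p/n}$$ (with conventions $1/0=\infty$, $1/\infty=0$, so that $\mathcal{H}_{p,\tau}(0)=0$). The general $p$-affine capacity of a compact set $K\subset\mathbb{R}^n$ is $$C_{p,\tau}(K)=\inf\{\mathcal{H}_{p,\tau}(f):\ f\in C_c^\infty(\mathbb{R}^n),\ f\ge1\text{ on }K\}.$$ *)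

(* Defs.v *)
From HB Require Import structures.
From mathcomp Require Import all_boot all_order all_algebra.
From mathcomp Require Import all_classical all_reals all_analysis.

Set Implicit Arguments.
Unset Strict Implicit.
Unset Printing Implicit Defensive.

Import Order.TTheory GRing.Theory Num.Theory.
Import numFieldNormedType.Exports.

Local Open Scope classical_set_scope.
Local Open Scope ring_scope.

(* 'rV[R]_n carries the sigma-algebra generated by the coordinates, i.e. its
   Borel sigma-algebra. *)
Section measurable_rV.
Context {R : realType}.

Definition rV_display : measure_display. Proof. exact. Qed.

Definition rV_coord n (i : 'I_n) (x : 'rV[R]_n) : measurableTypeR R := x ord0 i.

Section instance.
Variable n : nat.

Let rV_set0 : g_sigma_preimage (@rV_coord n) set0.
Proof. exact: sigma_algebra0. Qed.

Let rV_setC A : g_sigma_preimage (@rV_coord n) A ->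
  g_sigma_preimage (@rV_coord n) (~` A).
Proof. exact: sigma_algebraC. Qed.

Let rV_bigcup (F : (set 'rV[R]_n)^nat) :
  (forall i, g_sigma_preimage (@rV_coord n) (F i)) ->
  g_sigma_preimage (@rV_coord n) (\bigcup_i (F i)).
Proof. exact: sigma_algebra_bigcup. Qed.

HB.instance Definition _ := @isMeasurable.Build rV_display
  'rV[R]_n (g_sigma_preimage (@rV_coord n)) rV_set0 rV_setC rV_bigcup.

End instance.

Lemma measurable_rV_coord n (i : 'I_n) : measurable_fun setT (@rV_coord n i).
Proof.
move=> _ Y mY; rewrite setTI; apply: sub_sigma_algebra => /=.
rewrite -bigcup_seq/=; exists i => /=; first by rewrite mem_index_enum.
by exists Y => //; rewrite setTI.
Qed.

Lemma measurable_fun_rVP d (T : measurableType d) n (f : T -> 'rV[R]_n) :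
  measurable_fun setT f <->
  forall i, measurable_fun setT (@rV_coord n i \o f).
Proof.
split=> [mf i|mf]; first exact: measurableT_comp (measurable_rV_coord i) mf.
suff H : measurable `<=` [set A : set 'rV[R]_n | measurable (f @^-1` A)].
  by move=> _ A mA; rewrite setTI; exact: H.
apply: smallest_sub => /=.
  split=> /=.
  - by rewrite preimage_set0.
  - by move=> A mA; rewrite setTD preimage_setC; exact: measurableC.
  - by move=> F mF; rewrite preimage_bigcup; exact: bigcup_measurable.
rewrite -bigcup_seq => A [i _ [B mB <-]] /=.
by rewrite setTI -comp_preimage -[X in measurable X]setTI; exact: mf.
Qed.

Lemma measurable_rV_box n (A : 'I_n -> set (measurableTypeR R)) :
  (forall i, measurable (A i)) ->
  measurable [set x : 'rV[R]_n | forall i, A i (x ord0 i)].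
Proof.
move=> mA.
rewrite (_ : [set x | _] = \big[setI/setT]_(i < n) (@rV_coord n i @^-1` A i)).
  apply: bigsetI_measurable => i _.
  by rewrite -[X in measurable X]setTI; exact: measurable_rV_coord.
rewrite -bigcap_seq; apply/seteqP; split => [x Ax i _|x Ax i]; first exact: Ax.
by apply: Ax; rewrite /= mem_index_enum.
Qed.

End measurable_rV.

Section lebesgue_rV.
Context {R : realType}.

Section cons.
Variable n : nat.

Definition cons_rV (z : measurableTypeR R * 'rV[R]_n) : 'rV[R]_n.+1 :=
  row_mx (z.1%:M : 'rV[R]_1) z.2.

Definition uncons_rV (x : 'rV[R]_n.+1) : measurableTypeR R * 'rV[R]_n :=
  (x ord0 ord0, \row_i x ord0 (lift ord0 i)).

Lemma cons_rV0 z : cons_rV z ord0 ord0 = z.1.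
Proof.
have -> : ord0 = lshift n (ord0 : 'I_1) by apply/val_inj.
by rewrite /cons_rV (row_mxEl (z.1%:M : 'rV[R]_1)) mxE eqxx mulr1n.
Qed.

Lemma cons_rVS z (i : 'I_n) : cons_rV z ord0 (lift ord0 i) = z.2 ord0 i.
Proof.
have -> : lift ord0 i = rshift 1 i by apply/val_inj.
by rewrite /cons_rV (row_mxEr (z.1%:M : 'rV[R]_1)).
Qed.

Lemma cons_rVK : cancel cons_rV uncons_rV.
Proof.
move=> z; rewrite /uncons_rV cons_rV0 [RHS]surjective_pairing; congr pair.
by apply/rowP => i; rewrite mxE cons_rVS.
Qed.

Lemma uncons_rVK : cancel uncons_rV cons_rV.
Proof.
move=> x; apply/rowP => i; case: (unliftP ord0 i) => [j ->|->].
  by rewrite cons_rVS mxE.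
by rewrite cons_rV0.
Qed.

Lemma measurable_cons_rV : measurable_fun setT cons_rV.
Proof.
apply/measurable_fun_rVP => i; case: (unliftP ord0 i) => [j ->|->].
  rewrite (_ : _ \o _ = @rV_coord R n j \o snd).
    exact: measurableT_comp (measurable_rV_coord j) measurable_snd.
  by apply/funext => z /=; rewrite /rV_coord cons_rVS.
rewrite (_ : _ \o _ = fst); first exact: measurable_fst.
by apply/funext => z /=; rewrite /rV_coord cons_rV0.
Qed.

Lemma measurable_uncons_rV : measurable_fun setT uncons_rV.
Proof.
apply/measurable_fun_pairP; split.
  exact: (measurable_rV_coord (ord0 : 'I_n.+1)).
apply/measurable_fun_rVP => i.
rewrite (_ : _ \o _ = @rV_coord R n.+1 (lift ord0 i)).
  exact: measurable_rV_coord.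
by apply/funext => x; rewrite /rV_coord /= mxE.
Qed.

End cons.

Section step.
Local Open Scope ereal_scope.
Variables (n : nat) (mu : {sigma_finite_measure set 'rV[R]_n -> \bar R}).

Definition lebesgue_rV_step : set 'rV[R]_n.+1 -> \bar R :=
  pushforward (@lebesgue_measure R \x mu) (@cons_rV n).

Let step_measurable A : measurable A -> measurable (@cons_rV n @^-1` A).
Proof.
by move=> mA; rewrite -[X in measurable X]setTI; exact: measurable_cons_rV.
Qed.

Let step0 : lebesgue_rV_step set0 = 0.
Proof. by rewrite /lebesgue_rV_step /pushforward preimage_set0 measure0. Qed.

Let step_ge0 A : 0 <= lebesgue_rV_step A.
Proof. by rewrite /lebesgue_rV_step /pushforward; exact: measure_ge0. Qed.

Let step_sigma_additive : semi_sigma_additive lebesgue_rV_step.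
Proof.
move=> F mF tF mUF; rewrite /lebesgue_rV_step /pushforward preimage_bigcup.
apply: measure_semi_sigma_additive.
- by move=> i; exact: step_measurable.
- apply/trivIsetP => /= i j _ _ ij; rewrite -preimage_setI.
  by move/trivIsetP : tF => /(_ _ _ _ _ ij) ->//; rewrite preimage_set0.
- by rewrite -preimage_bigcup; exact: step_measurable.
Qed.

HB.instance Definition _ := isMeasure.Build _ _ _ lebesgue_rV_step
  step0 step_ge0 step_sigma_additive.

Let step_sigma_finite : sigma_finite setT lebesgue_rV_step.
Proof.
have /sigma_finiteP[F [FT ndF Foo]] := sigma_finiteT (@lebesgue_measure R).
have /sigma_finiteP[G [GT ndG Goo]] := sigma_finiteT mu.
exists (fun i => @uncons_rV n @^-1` (F i `*` G i)).
  apply/esym/seteqP; split => // x _.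
  have [k _ Fk] : (\bigcup_i F i) (uncons_rV x).1 by rewrite -FT.
  have [l _ Gl] : (\bigcup_i G i) (uncons_rV x).2 by rewrite -GT.
  exists (maxn k l) => //; split.
    by apply/subsetPset/ndF : Fk; exact: leq_maxl.
  by apply/subsetPset/ndG : Gl; exact: leq_maxr.
move=> i; have [mF Fi] := Foo i; have [mG Gi] := Goo i.
have mFG : measurable (F i `*` G i) by exact: measurableX.
split; first by rewrite -[X in measurable X]setTI; exact: measurable_uncons_rV.
rewrite /lebesgue_rV_step /pushforward -comp_preimage.
rewrite (_ : _ \o _ = id); last by apply/funext => z /=; rewrite cons_rVK.
by rewrite preimage_id product_measure1E// lte_mul_pinfty// ge0_fin_numE.
Qed.

HB.instance Definition _ := Measure_isSigmaFinite.Build _ _ _ lebesgue_rV_step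
  step_sigma_finite.

End step.

Fixpoint lebesgue_rV n : {sigma_finite_measure set 'rV[R]_n -> \bar R} :=
  match n with
  | 0 => dirac (0 : 'rV[R]_0)
  | m.+1 => lebesgue_rV_step (lebesgue_rV m)
  end.

Lemma lebesgue_rV_box n (A : 'I_n -> set (measurableTypeR R)) :
  (forall i, measurable (A i)) ->
  lebesgue_rV n [set x | forall i, A i (x ord0 i)] =
  (\prod_(i < n) @lebesgue_measure R (A i))%E.
Proof.
elim: n A => [|n IH] A mA.
  by rewrite big_ord0 /= /dirac indicE mem_set// => -[].
rewrite big_ord_recl -IH//= /lebesgue_rV_step /pushforward.
rewrite -product_measure1E//; last first.
  by apply: (@measurable_rV_box R n (fun i => A (lift ord0 i))) => i; exact: mA.
congr (product_measure1 _ _ _).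
apply/seteqP; split => [z /= Az|z /= [Az0 AzS] i].
  split; first by have := Az ord0; rewrite cons_rV0.
  by move=> i; have := Az (lift ord0 i); rewrite cons_rVS.
by case: (unliftP ord0 i) => [j ->|->]; rewrite ?cons_rVS ?cons_rV0.
Qed.

End lebesgue_rV.

Section functionals.
Context {R : realType} {n : nat}.
Implicit Types (u x : 'rV[R]_n) (f : 'rV[R]_n -> R).

(* The library norm `|x| on 'rV[R]_n is the sup norm; the Euclidean structure
   is therefore written out. *)
Definition dotprod u x : R := \sum_i u ord0 i * x ord0 i.

Definition unit_sphere : set 'rV[R]_n := [set u | Num.sqrt (dotprod u u) = 1].

Definition is_rotation (Q : 'M[R]_n) := Q *m Q^T = 1%:M /\ \det Q = 1.

Definition rotation_invariant (sigma : set 'rV[R]_n -> \bar R) :=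
  forall Q, is_rotation Q -> forall A, measurable A ->
    sigma [set x | A (x *m Q)] = sigma A.

(* A measure on the sphere is encoded as a measure on 'rV[R]_n carried by the
   sphere; for 2 <= n there is exactly one such rotation-invariant probability
   (on the Borel sets). *)
Definition uniform_on_sphere (sigma : probability 'rV[R]_n R) :=
  sigma unit_sphere = 1%E /\ rotation_invariant sigma.

Definition partial (i : 'I_n) f : 'rV[R]_n -> R := 'D_(delta_mx ord0 i) f.

Definition smooth f := forall s : seq 'I_n,
  continuous (foldr partial f s) /\
  forall i x, derivable (foldr partial f s) x (delta_mx ord0 i).

Definition test_function f :=
  smooth f /\ compact (closure [set x | f x != 0]).

Definition gradient f x : 'rV[R]_n := \row_i partial i f x.

Definition phi (p tau t : R) : R :=
  ((1 + tau) / 2) `^ p^-1 * Num.max t 0 +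
  ((1 - tau) / 2) `^ p^-1 * Num.max (- t) 0.

Local Open Scope ereal_scope.

(* A negative power y ^ (- a) is written (y `^ a)^-1: on \bar R the library has
   0^-1 = +oo and +oo^-1 = 0, whereas poweR with a negative exponent sends 0 to
   0 and +oo to +oo. *)
Definition affine_energy (sigma : probability 'rV[R]_n R) (p tau : R) f :
    \bar R :=
  ((\int[sigma]_(u in unit_sphere)
      ((\int[lebesgue_rV n]_x (phi p tau (dotprod u (gradient f x)) `^ p)%:E)
         `^ (n%:R / p))^-1)
     `^ (p / n%:R))^-1.

Definition affine_capacity (sigma : probability 'rV[R]_n R) (p tau : R)
    (K : set 'rV[R]_n) : \bar R :=
  ereal_inf [set affine_energy sigma p tau f | f in
    [set f | test_function f /\ forall x, K x -> (1 <= f x)%R]].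

End functionals.

(* Main.v *)
(** If a test function [f] is at least 1 on the intersection and [0 < c < 1],
    the open set [{f > c}] contains some [K i] by compactness, so [f / c]
    competes for the capacity of [K i]; by homogeneity its energy is
    [c^-p] times that of [f], and [c] tends to 1. *)
Require Import Defs.
From mathcomp Require Import all_boot all_order all_algebra.
From mathcomp Require Import all_classical all_reals all_analysis.
Import Order.TTheory GRing.Theory Num.Theory.
Import numFieldNormedType.Exports.

Local Open Scope classical_set_scope.
Local Open Scope ring_scope.

(** If no [K i] lies in [U], pick [x i] in [K i] outside [U]. Compactness of [K 0] gives a cluster
    point [y]; the tails of the sequence lie in the closed sets [K i] and in the closed complement
    of [U], so [y] is in the intersection but not in [U]. *)
Lemma bigcap_compact_subset_open (T : topologicalType) (K : nat -> set T)
    (U : set T) :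
  hausdorff_space T -> (forall i, compact (K i)) ->
  (forall i, K i.+1 `<=` K i) -> open U -> \bigcap_i K i `<=` U ->
  exists i, K i `<=` U.
Proof.
move=> hT cK dK oU KU; apply: contrapT => /forallNP nKU.
have {nKU} /choice[x Kx] i : exists x, K i x /\ ~ U x.
  by have /existsNP[x /not_implyP ?] := nKU i; exists x.
have mK i j : (i <= j)%N -> K j `<=` K i.
  by elim: j => [|j IH]; [rewrite leqn0 => /eqP ->|
    rewrite leq_eqVlt => /predU1P[->//|/IH KK] y /dK /KK].
have [] := cK 0%N (x @ \oo).
  by exists 0%N => // i _; exact: (mK 0%N i _ _ (Kx i).1).
move=> y []; rewrite clusterE => _ cly.
have : U y.
  apply: KU => i _; apply: (compact_closed hT (cK i)); apply: cly.
  by exists i => // j /= ij; exact: (mK i j _ _ (Kx j).1).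
suff : (~` U) y by [].
move/closure_id : (open_closedC oU) => ->; apply: cly.
by exists 0%N => // i _; exact: (Kx i).2.
Qed.

Section positive_scaling.
Local Open Scope ereal_scope.
Import HBNNSimple.

(* A nonnegative integral is the supremum over the simple functions below the
   integrand, a family that scales, hence [f] may be nonmeasurable. *)
Lemma ge0_integralZl_pos d (T : measurableType d) (R : realType)
    (mu : {measure set T -> \bar R}) (D : set T) (f : T -> \bar R) (k : R) :
  (0 < k)%R -> (forall x, D x -> 0 <= f x) ->
  \int[mu]_(x in D) (k%:E * f x) = k%:E * \int[mu]_(x in D) f x.
Proof.
have le g c : (0 < c)%R -> (forall x, D x -> 0 <= g x) ->
    c%:E * \int[mu]_(x in D) g x <= \int[mu]_(x in D) (c%:E * g x).
  move=> c0 g0; rewrite -lee_pdivlMl// ge0_integralE//.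
  apply: ge_ereal_sup => _ [h hg <-]; rewrite lee_pdivlMl//.
  rewrite ge0_integralE; last by move=> x Dx; rewrite mule_ge0 ?g0// ltW.
  apply: ereal_sup_ubound.
  exists (scale_nnsfun h (ltW c0)); last exact: sintegralrM.
  (* Off [D] the restricted integrand is 0, so [h x] is at most 0 there and remains so after
     scaling. *)
  move=> x /=; have := hg x; rewrite EFinM /patch; case: ifPn => _ hgx.
    by rewrite lee_pmul2l.
  by rewrite mule_ge0_le0// ltW.
move=> k0 f0; apply/eqP; rewrite eq_le le// andbT.
(* The converse inequality is [le] itself, for the factor [k^-1] and the function [k * f]. *)
rewrite -[leLHS]mul1e -(divff (lt0r_neq0 k0)) EFinM -muleA.
rewrite lee_pmul2l//; apply: le_trans (le _ _ _ _) _; rewrite ?invr_gt0//.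
  by move=> x Dx; rewrite mule_ge0 ?f0// ltW.
by under eq_integral do rewrite muleA -EFinM mulVf ?lt0r_neq0// mul1e.
Qed.

(** A positive real [c] rules out the product of 0 and [+oo], on which inversion is not
    multiplicative. *)
Lemma inveZ_pos (R : realType) (c : R) (x : \bar R) :
  (0 < c)%R -> (c%:E * x)^-1 = c^-1%:E * x^-1.
Proof.
move=> c0; rewrite inveM; first by rewrite inver gt_eqF.
by rewrite inveM_defE eqe gt_eqF// ltry lee_fin (ltW c0) lte_fin c0 !implybT.
Qed.

Lemma poweRZ_pos (R : realType) (c : R) (x : \bar R) (r : R) :
  (0 < c)%R -> 0 <= x -> (c%:E * x) `^ r = (c `^ r)%:E * x `^ r.
Proof. by move=> c0 x0; rewrite poweRM ?poweR_EFin// lee_fin ltW. Qed.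

(** The factor leaves the integral with exponent [- s], the outer power turns this into [- (s * t)],
    and the outer inverse restores the sign. *)
Lemma negative_momentZ d (T : measurableType d) (R : realType)
    (mu : {measure set T -> \bar R}) (D : set T) (F : T -> \bar R)
    (a s t : R) :
  (0 < a)%R -> (forall u, D u -> 0 <= F u) ->
  ((\int[mu]_(u in D) ((a%:E * F u) `^ s)^-1) `^ t)^-1 =
  (a `^ (s * t))%:E * ((\int[mu]_(u in D) (F u `^ s)^-1) `^ t)^-1.
Proof.
move=> a0 F0; have as0 : (0 < a `^ s)%R by exact: powR_gt0.
have -> : \int[mu]_(u in D) ((a%:E * F u) `^ s)^-1 =
    (a `^ s)^-1%:E * \int[mu]_(u in D) (F u `^ s)^-1.
  rewrite -ge0_integralZl_pos ?invr_gt0//; last first.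
    by move=> u _; rewrite inve_ge0 poweR_ge0.
  apply: eq_integral => u /set_mem Du.
  by rewrite poweRZ_pos ?F0// inveZ_pos.
have I0 : 0 <= \int[mu]_(u in D) (F u `^ s)^-1.
  by apply: integral_ge0 => u _; rewrite inve_ge0 poweR_ge0.
have aE : (((a `^ s)^-1 `^ t)^-1 = a `^ (s * t))%R.
  by rewrite -!powRN -powRrM mulrNN.
by rewrite poweRZ_pos ?invr_gt0// inveZ_pos ?powR_gt0 ?invr_gt0// aE.
Qed.

End positive_scaling.

Section scaling.
Context {R : realType} {n : nat}.
Implicit Types (f : 'rV[R]_n -> R) (c : R).

Lemma foldr_partialZ c f (s : seq 'I_n) : smooth f ->
  foldr partial (c \*: f) s = c \*: foldr partial f s.
Proof.
move=> sf; elim: s => //= i s ->; apply/funext => x; rewrite /partial.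
by rewrite deriveZ//; exact: (sf s).2.
Qed.

Lemma test_functionZ c f : c != 0 -> test_function f -> test_function (c \*: f).
Proof.
move=> c0 [sf cf]; split.
  move=> s; rewrite foldr_partialZ//; have [cs ds] := sf s; split.
    by move=> x; apply: continuousZr; exact: cs.
  by move=> i x; apply: derivableZ; exact: ds.
rewrite (_ : [set x | _] = [set x | f x != 0])//.
by apply/seteqP; split=> x /=; rewrite mulf_eq0 (negbTE c0).
Qed.

Lemma gradientZ c f x : smooth f -> gradient (c \*: f) x = c *: gradient f x.
Proof.
move=> sf; apply/rowP => i; rewrite !mxE /partial deriveZ//.
exact: (sf [::]).2.
Qed.

Lemma dotprodZr c (u x : 'rV[R]_n) : dotprod u (c *: x) = c * dotprod u x.
Proof.
by rewrite /dotprod mulr_sumr; apply: eq_bigr => i _; rewrite mxE mulrCA.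
Qed.

(** Homogeneity is one-sided: a negative factor would exchange the two maxima, whose weights may
    differ. *)
Lemma phiZ (p tau c t : R) : 0 <= c -> phi p tau (c * t) = c * phi p tau t.
Proof.
by move=> c0; rewrite /phi mulrDr !(mulrCA c) !(maxr_pMr _ _ c0) mulr0 mulrN.
Qed.

Lemma phi_ge0 (p tau t : R) : 0 <= phi p tau t.
Proof. by rewrite addr_ge0// mulr_ge0 ?powR_ge0// le_max lexx orbT. Qed.

(** The inner integral of [affine_energy], isolated to play the role of [F] in
    [negative_momentZ]. *)
Definition directional_energy (p tau : R) f (u : 'rV[R]_n) : \bar R :=
  (\int[lebesgue_rV n]_x (phi p tau (dotprod u (gradient f x)) `^ p)%:E)%E.

Lemma directional_energy_ge0 (p tau : R) f u :
  (0 <= directional_energy p tau f u)%E.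
Proof. by apply: integral_ge0 => x _; rewrite lee_fin powR_ge0. Qed.

Lemma directional_energyZ (p tau c : R) f u : 0 < c -> smooth f ->
  directional_energy p tau (c \*: f) u =
  ((c `^ p)%:E * directional_energy p tau f u)%E.
Proof.
move=> c0 sf; rewrite /directional_energy.
transitivity (\int[lebesgue_rV n]_x
    ((c `^ p)%:E * (phi p tau (dotprod u (gradient f x)) `^ p)%:E))%E.
  apply: eq_integral => x _.
  by rewrite (gradientZ _ _ _ sf) dotprodZr phiZ ?ltW// powRM ?phi_ge0 ?ltW.
apply: ge0_integralZl_pos => [|x _]; first exact: powR_gt0.
by rewrite lee_fin powR_ge0.
Qed.

(* Homogeneous of degree p, not 1: [affine_energy] carries no outer 1/p-th
   power. *)
Lemma affine_energyZ (sigma : probability 'rV[R]_n R) (p tau c : R) f :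
  (0 < n)%N -> 0 < p -> 0 < c -> smooth f ->
  affine_energy sigma p tau (c \*: f) =
  ((c `^ p)%:E * affine_energy sigma p tau f)%E.
Proof.
move=> n0 p0 c0 sf.
have npK : n%:R / p * (p / n%:R) = 1 :> R.
  by rewrite mulrA divfK ?divff// lt0r_neq0// ltr0n.
transitivity ((\int[sigma]_(u in unit_sphere)
    (((c `^ p)%:E * directional_energy p tau f u) `^ (n%:R / p))^-1)
  `^ (p / n%:R))^-1%E.
  congr ((_ `^ _)^-1)%E; apply: eq_integral => u _.
  by congr ((_ `^ _)^-1)%E; exact: directional_energyZ.
rewrite negative_momentZ ?npK ?powRr1 ?powR_ge0 ?powR_gt0//.
by move=> u _; exact: directional_energy_ge0.
Qed.

Lemma affine_energy_ge0 (sigma : probability 'rV[R]_n R) (p tau : R) f :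
  (0 <= affine_energy sigma p tau f)%E.
Proof. by rewrite inve_ge0 poweR_ge0. Qed.

Lemma affine_capacity_ge0 (sigma : probability 'rV[R]_n R) (p tau : R)
  (K : set 'rV[R]_n) : (0 <= affine_capacity sigma p tau K)%E.
Proof. by apply: le_ereal_inf_tmp => _ [f _ <-]; exact: affine_energy_ge0. Qed.

Lemma le_affine_capacity (sigma : probability 'rV[R]_n R) (p tau : R)
    (K L : set 'rV[R]_n) : K `<=` L ->
  (affine_capacity sigma p tau K <= affine_capacity sigma p tau L)%E.
Proof.
move=> KL; apply: le_ereal_inf => _ [f [tf f1] <-]; exists f => //.
by split=> // x /KL; exact: f1.
Qed.

End scaling.

Theorem theorem4p2 (R : realType) (n : nat) (sigma : probability 'rV[R]_n R)
    (p tau : R) (K : nat -> set 'rV[R]_n) :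
  (2 <= n)%N -> uniform_on_sphere sigma ->
  1 <= p < n%:R -> -1 <= tau <= 1 ->
  (forall i, compact (K i)) -> (forall i, K i.+1 `<=` K i) ->
  affine_capacity sigma p tau (K i) @[i --> \oo] -->
    affine_capacity sigma p tau (\bigcap_i K i).
Proof.
move=> n2 _ /andP[p1 _] _ cK dK.
have n0 : (0 < n)%N by exact: leq_trans n2.
have p0 : 0 < p by exact: lt_le_trans p1.
set C := affine_capacity sigma p tau.
(* The capacities decrease along [K], hence converge to their infimum. *)
suff -> : C (\bigcap_i K i) = ereal_inf (range (C \o K)).
  apply: ereal_nonincreasing_cvgn.
  apply: homo_leq (fun x => lexx x) (fun y x z xy yz => le_trans yz xy) _.
  by move=> i; exact: le_affine_capacity.
apply/eqP; rewrite eq_le; apply/andP; split.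
  apply: le_ereal_inf_tmp => _ [i _ <-]; apply: le_affine_capacity.
  exact: bigcap_inf.
apply: le_ereal_inf_tmp => _ [f [tf f1] <-].
(* It suffices to bound [r] times the infimum for each [r] in (0, 1); this leaves room to lower the
   level of [f] below 1. *)
apply/lee_mul01Pr.
  by apply: le_ereal_inf_tmp => _ [i _ <-]; exact: affine_capacity_ge0.
move=> r /andP[r0 r1].
set c := r `^ p^-1.
have c0 : 0 < c by exact: powR_gt0.
have cp : c `^ p = r by rewrite -powRrM mulVf ?powRr1 ?ltW// lt0r_neq0.
have c1 : c < 1.
  have -> : 1 = 1 `^ p^-1 :> R by rewrite powR1.
  by rewrite gt0_ltr_powR ?invr_gt0 ?nnegrE ?ler01 ?(ltW r0).
have [|x Kx|i Kc] := @bigcap_compact_subset_open _ K [set x | c < f x]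
    (@norm_hausdorff _ _) cK dK.
- apply: (@open_comp _ _ f [set y | c < y]); last exact: open_gt.
  by move=> x _; exact: (tf.1 [::]).1.
- exact: lt_le_trans c1 (f1 x Kx).
rewrite -lee_pdivlMl//.
have cVp : c^-1 `^ p = r^-1.
  by rewrite -powR_inv1 ?ltW// -powRrM mulN1r powRN cp.
rewrite -cVp -affine_energyZ ?invr_gt0//; last exact: tf.1.
apply: (@le_trans _ _ (C (K i))); first by apply: ereal_inf_lbound; exists i.
apply: ereal_inf_lbound; exists (c^-1 \*: f) => //; split.
  by apply: test_functionZ tf; rewrite invr_neq0// lt0r_neq0.
move=> x /Kc /= /ltW cf.
by rewrite -(mulVf (lt0r_neq0 c0)) ler_pM2l ?invr_gt0.
Qed.
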